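(* Let $\mathcal{N}$ be a workflow net and let $\mathrm{Sound}(\mathcal{N})=\{k\ge 1\mid \mathcal{N}\text{ is }k\text{-sound}\}$. There exist $p>0$ and $k\in\mathbb{N}\cup\{+\infty\}$ such that $\mathrm{Sound}(\mathcal{N})=\{i\cdot p\mid i\in\mathbb{N},\ 1\le i<k\}$.
   Context: A Petri net is a triple $\mathcal{N}=(P,T,F)$ where $P$ (places) and $T$ (transitions) are disjoint finite sets and $F\colon (P\times T)\cup(T\times P)\to\mathbb{N}$. A marking is a vector $m\in\mathbb{N}^P$. For $t\in T$ let $\mathrm{pre}_t[p]=F(p,t)$ and $\mathrm{post}_t[p]=F(t,p)$. Transition $t$ is enabled in $m$ if $m\ge \mathrm{pre}_t$ (componentwise); firing it leads to $m'=m-\mathrm{pre}_t+\mathrm{post}_t$. Write $m\to^* m'$ if $m'$ is obtained from $m$ by firing a finite (possibly empty) sequence of successively enabled transitions. $\{p\colon k\}$ denotes the marking with $k$ tokens in $p$ and $0$ elsewhere. A workflow net is a Petri net with two distinct designated places $\mathsf{i}$ (initial) and $\mathsf{f}$ (final) such that $F(t,\mathsf{i})=0$ and $F(\mathsf{f},t)=0$ for all $t\in T$, and every place and every transition lies on a directed path from $\mathsf{i}$ to $\mathsf{f}$ in the graph with vertex set $P\cup T$ and edges $(u,v)$ whenever $F(u,v)>0$. A workflow net is $k$-sound if $\{\mathsf{i}\colon k\}\to^* m$ implies $m\to^*\{\mathsf{f}\colon k\}$, for all markings $m$. *)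

(* Defs.v *)
From mathcomp Require Import all_boot.

Set Implicit Arguments.
Unset Strict Implicit.
Unset Printing Implicit Defensive.

(* Places and transitions are two finite types, hence disjoint; the flow
   function F on (P x T) u (T x P) is given by its two restrictions. *)
Record petri_net (P T : finType) := PetriNet {
  flow_pt : P -> T -> nat;
  flow_tp : T -> P -> nat
}.

Definition marking (P : finType) := {ffun P -> nat}.

Definition single (P : finType) (p : P) (k : nat) : marking P :=
  [ffun q => if q == p then k else 0].

Section Semantics.
Variables (P T : finType) (N : petri_net P T).

Definition pre (t : T) : marking P := [ffun p => flow_pt N p t].
Definition post (t : T) : marking P := [ffun p => flow_tp N t p].

Definition enabled (m : marking P) (t : T) : bool :=
  [forall p, pre t p <= m p].

(* Truncated subtraction is harmless: firing is only used when t is enabled. *)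
Definition fire (m : marking P) (t : T) : marking P :=
  [ffun p => m p - pre t p + post t p].

Fixpoint firing (m : marking P) (s : seq T) (m' : marking P) : Prop :=
  if s is t :: s' then enabled m t /\ firing (fire m t) s' m' else m = m'.

Definition reachable (m m' : marking P) : Prop := exists s, firing m s m'.

Definition edge : rel (P + T) := fun u v =>
  match u, v with
  | inl p, inr t => 0 < flow_pt N p t
  | inr t, inl p => 0 < flow_tp N t p
  | _, _ => false
  end.

Definition on_path (a b v : P + T) : Prop :=
  exists s, [/\ path edge a s, last a s = b & v \in a :: s].

End Semantics.

Record workflow_net (P T : finType) := WorkflowNet {
  wf_net :> petri_net P T;
  initial : P;
  final : P;
  initial_neq_final : initial <> final;
  initial_source : forall t, flow_tp wf_net t initial = 0;
  final_sink : forall t, flow_pt wf_net final t = 0;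
  all_on_path : forall v : P + T, on_path wf_net (inl initial) (inl final) v
}.

Definition k_sound (P T : finType) (N : workflow_net P T) (k : nat) : Prop :=
  forall m : marking P,
    reachable N (single (initial N) k) m -> reachable N m (single (final N) k).

Definition Sound (P T : finType) (N : workflow_net P T) (k : nat) : Prop :=
  1 <= k /\ k_sound N k.

(* N u {+oo} is encoded as option nat, with None standing for +oo. *)
Definition ltn_ext (i : nat) (k : option nat) : bool :=
  if k is Some k' then i < k' else true.

(* Main.v *)
(** If the net is [j]-sound and [(n + j)]-sound then it is [n]-sound: from
    [{i: n} ->* m] we get [{i: n + j} ->* m + {i: j} ->* m + {f: j}], hence
    [m + {f: j} ->* {f: n + j}]; no transition consumes from [f], so the same
    sequence fires without the [j] extra tokens, giving [m ->* {f: n}].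
    A set of positive integers closed under positive differences consists of
    multiples of its least element [p], and is downward closed among them. *)
Require Import Defs.
From mathcomp Require Import all_boot.
From Stdlib Require Import Classical Wf_nat.

Set Implicit Arguments.
Unset Strict Implicit.
Unset Printing Implicit Defensive.

Definition addm (P : finType) (m d : marking P) : marking P :=
  [ffun p => m p + d p].

Lemma addmC (P : finType) (m d : marking P) : addm m d = addm d m.
Proof. by apply/ffunP=> p; rewrite !ffunE addnC. Qed.

Lemma addm_inj (P : finType) (d : marking P) : injective (fun m => addm m d).
Proof.
move=> m1 m2 E; apply/ffunP=> p; apply: (@addIn (d p)).
by have /ffunP/(_ p) := E; rewrite !ffunE.
Qed.

Lemma single_add (P : finType) (p : P) (j k : nat) :
  single p (j + k) = addm (single p j) (single p k).
Proof. by apply/ffunP=> q; rewrite !ffunE; case: ifP. Qed.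

Section PetriNets.
Variables (P T : finType) (N : petri_net P T).
Implicit Types (m d : marking P) (t : T) (s : seq T).

Lemma firing_cat m1 m2 m3 s1 s2 :
  firing N m1 s1 m2 -> firing N m2 s2 m3 -> firing N m1 (s1 ++ s2) m3.
Proof.
elim: s1 m1 => [|t s1 IHs] m1 /= => [-> // | [en1 fs1] fs2].
by split=> //; apply: IHs.
Qed.

Lemma reachable_trans m2 m1 m3 :
  reachable N m1 m2 -> reachable N m2 m3 -> reachable N m1 m3.
Proof.
by move=> [s1 f1] [s2 f2]; exists (s1 ++ s2); apply: firing_cat f1 f2.
Qed.

(** Enabledness in [m] itself is essential: truncated subtraction commutes with adding [d] only
    where [pre t] is below [m]. *)
Lemma fire_add m d t : enabled N m t -> fire N (addm m d) t = addm (fire N m t) d.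
Proof.
move/forallP=> en; apply/ffunP=> p; have := en p; rewrite !ffunE => le_pre.
by rewrite -addnBAC // addnAC.
Qed.

Lemma firing_add m d s m' :
  firing N m s m' -> firing N (addm m d) s (addm m' d).
Proof.
elim: s m => [|t s IHs] m /= => [-> // | [en fs]]; split.
  apply/forallP=> p; rewrite (leq_trans (forallP en p)) //.
  by rewrite [leqRHS]ffunE leq_addr.
by rewrite fire_add //; apply: IHs.
Qed.

Lemma reachable_add m d m' :
  reachable N m m' -> reachable N (addm m d) (addm m' d).
Proof. by move=> [s fs]; exists s; apply: firing_add. Qed.

(** Converse of [reachable_add] when [d] lives on places without outgoing arcs: tokens there never
    help to enable a transition. *)
Lemma reachable_add_sinkV d m m' :
    (forall p t, d p != 0 -> flow_pt N p t = 0) ->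
  reachable N (addm m d) (addm m' d) -> reachable N m m'.
Proof.
move=> sink_d [s fs]; exists s; elim: s m fs => [|t s IHs] m /=.
  exact: addm_inj.
move=> [/forallP en fs].
have en' : enabled N m t.
  (* Either [d] adds nothing at [p], or [t] demands nothing from [p]. *)
  apply/forallP=> p; have := en p; rewrite !ffunE.
  by have [-> | /sink_d->] := eqVneq (d p) 0; rewrite ?addn0.
by split=> //; apply: IHs; rewrite -fire_add.
Qed.

End PetriNets.

Lemma k_sound_sub (P T : finType) (N : workflow_net P T) (j n : nat) :
  k_sound N j -> k_sound N (n + j) -> k_sound N n.
Proof.
move=> sound_j sound_nj m reach_m.
have reach_f : reachable N (single (initial N) j) (single (final N) j).
  by apply: sound_j; exists [::].
apply: (@reachable_add_sinkV _ _ _ (single (final N) j)).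
  move=> p t; rewrite ffunE.
  by have [-> _ | //] := eqVneq p (final N); apply: final_sink.
rewrite -single_add; apply: sound_nj; rewrite single_add.
apply: reachable_trans (reachable_add _ reach_m) _.
(* Swapping the summands makes [m] the idle part while the [j] initial tokens move to the final
   place. *)
by rewrite addmC (addmC m); apply: reachable_add.
Qed.

(** Excluded middle stands in for decidability of [Q], since soundness is only a proposition
    here. *)
Lemma ex_least (Q : nat -> Prop) :
  (exists n, Q n) -> exists2 n, Q n & forall m, Q m -> n <= m.
Proof.
move=> exQ.
have [n [[Qn le_n] _]] :=
  dec_inh_nat_subset_has_unique_least_element Q (fun n => classic (Q n)) exQ.
by exists n => // m /le_n/leP.
Qed.

Lemma sub_closed_multiples (S : nat -> Prop) :
    (forall n, S n -> 0 < n) ->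
    (forall j n, 0 < n -> S j -> S (n + j) -> S n) ->
  exists (p : nat) (k : option nat), 0 < p /\
    forall n, S n <-> exists i, [/\ n = i * p, 1 <= i & ltn_ext i k].
Proof.
move=> S_gt0 S_sub; have [exS | noS] := classic (exists n, S n); last first.
  (* For empty [S], the bound 1 leaves no index [i] with [1 <= i < 1]. *)
  exists 1, (Some 1); split=> // n; split=> [Sn | [[|i] []] //].
  by case: noS; exists n.
have [p Sp p_min] := ex_least exS; have p_gt0 := S_gt0 p Sp.
(* Subtracting [p] stays inside [S] while the result is positive; by minimality the descent can only
   stop at [p]. *)
have S_mul n : S n -> exists2 i, n = i * p & 0 < i.
  elim/ltn_ind: n => n IHn Sn.
  have [lt_pn | le_np] := ltnP p n; last first.
    by exists 1 => //; apply/eqP; rewrite mul1n eqn_leq le_np p_min.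
  have S_np : S (n - p) by apply: (S_sub p); rewrite ?subn_gt0 // subnK // ltnW.
  have [|i Ei i_gt0] := IHn (n - p) _ S_np.
    by rewrite ltn_subrL p_gt0 (ltn_trans p_gt0).
  by exists i.+1 => //; rewrite mulSn -Ei subnKC // ltnW.
have S_down k i : 0 < i <= k -> S (k * p) -> S (i * p).
  case/andP=> i_gt0; elim: k => [|k IHk]; first by case: (i) i_gt0.
  rewrite leq_eqVlt => /orP[/eqP<- // | le_ik] Sk; apply: IHk => //.
  (* One [p] is removed at a time; [k * p] is positive because [0 < i <= k]. *)
  apply: (S_sub p) => //; last by rewrite addnC -mulSn.
  by rewrite muln_gt0 p_gt0 (leq_trans i_gt0).
(* The bound is the least positive index whose multiple of [p] is missing from [S], infinite if none
   is; by [S_down] no later multiple returns. *)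
have [exU | noU] := classic (exists i, 0 < i /\ ~ S (i * p)).
  have [k [k_gt0 nSk] k_min] := ex_least exU.
  exists p, (Some k); split=> // n; split=> [Sn | [i [-> i_gt0 /= lt_ik]]].
    have [i En i_gt0] := S_mul n Sn; exists i; split=> //=; rewrite ltnNge.
    by apply/negP=> le_ki; apply: nSk; apply: (S_down i); rewrite ?k_gt0 -?En.
  by apply: NNPP => nSi; have := k_min i (conj i_gt0 nSi); rewrite leqNgt lt_ik.
exists p, None; split=> // n; split=> [/S_mul[i -> i_gt0] | [i [-> i_gt0 _]]].
  by exists i.
by apply: NNPP => nSi; apply: noU; exists i.
Qed.

Theorem corollary7p2 (P T : finType) (N : workflow_net P T) :
  exists (p : nat) (k : option nat),
    0 < p /\
    forall n : nat,
      Sound N n <-> exists i : nat, [/\ n = i * p, 1 <= i & ltn_ext i k].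
Proof.
apply: sub_closed_multiples => [n [] // | j n n_gt0 [_ sound_j] [_ sound_nj]].
by split=> //; apply: k_sound_sub sound_j sound_nj.
Qed.
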